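(* Let $p$ be an odd prime, $E\subseteq\mathbb{F}_p^2$ and $S\subseteq SL_2(\mathbb{F}_p)$. (a) If $|E|\ge 4p$ and $|S|\gg p^2$, then there exists $x\in E$ such that $|S(E-x)|\gg p^2$. (b) If every line through the origin contains at most $k$ points of $E$, then \[|S(E)|\gg\min\left\{p^2,~\frac{|S||E|}{pk}\right\}.\]
   Context: Matrices act on column vectors; $S(E)=\{\theta e:e\in E,\theta\in S\}$ and $E-x=\{e-x:e\in E\}$. A line through the origin is a one-dimensional subspace of $\mathbb{F}_p^2$. $X\gg Y$ means $X\ge cY$ for a constant $c>0$ independent of $p,E,S,k$ (in (a), the constant in the conclusion depends only on the constant in the hypothesis $|S|\gg p^2$).
   Formalization: In (b) the set E = {0} is excluded: with k = 1 and S = SL_2(F_p) one has |S(E)| = 1 while min{p^2, |S||E|/(pk)} = p^2 − 1, so the stated bound fails for it. *)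

(* Defs.v *)
From HB Require Import structures.
From mathcomp Require Import all_boot all_order all_algebra.
From mathcomp Require Import reals.
Set Implicit Arguments.
Unset Strict Implicit.
Unset Printing Implicit Defensive.
Import Order.TTheory GRing.Theory Num.Theory.
Local Open Scope ring_scope.

Definition SL2 (p : nat) : {set 'M['F_p]_2} := [set A | \det A == 1].

Definition mxact (p : nat) (S : {set 'M['F_p]_2}) (E : {set 'cV['F_p]_2}) :
    {set 'cV['F_p]_2} :=
  [set A *m e | A in S, e in E].

Definition translate (p : nat) (E : {set 'cV['F_p]_2}) (x : 'cV['F_p]_2) :
    {set 'cV['F_p]_2} :=
  [set e - x | e in E].

(* When k = 0 the set E is empty: the origin belongs to every line, and every
   other vector spans one.  The origin counts on every line, so E = {0} satisfies
   this with k = 1 although SL2 fixes it: a lower bound on #|mxact S E| of order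
   min(p^2, #|S| #|E| / (p k)) has to exclude that one set. *)
Definition lines_through_origin_le (p : nat) (E : {set 'cV['F_p]_2}) (k : nat) :
    Prop :=
  forall L : {vspace 'cV['F_p]_2},
    \dim L = 1%N -> (#|[set e in E | e \in L]| <= k)%N.

(* Main.v *)
Require Import Defs.
From HB Require Import structures.
From mathcomp Require Import all_boot all_order all_algebra.
From mathcomp Require Import reals ring lra zify.
Set Implicit Arguments.
Unset Strict Implicit.
Unset Printing Implicit Defensive.
Import Order.TTheory GRing.Theory Num.Theory.
Local Open Scope ring_scope.

(* For (b), drop the origin from E and put T = S(E).  The number I(g) of e in E
   with g e in T equals |E| for every g in S, while over the whole of SL_2 its
   variance is small.  Indeed two independent vectors e, e' are moved to t, t' by
   at most one g, and only when det(e, e') = det(t, t'), so the second moment of I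
   counts the solutions of this equation in E x E x T x T.  The equation says that
   (e, t) and (e', t') are orthogonal for a symplectic form on F^4, and the
   functions q 1_{u.v = 0} - 1 are orthogonal for independent u, which together
   with their homogeneity bounds the number of solutions: a line through the
   origin contains at most k points of E x T.

   For (a), for each of the q slopes at most q points of E are alone on their
   line of that slope, so some x in E sees other points of E along at least 3q/4
   slopes.  Choosing one point for each such slope gives a subset of E - x to which
   (b) applies with k = 1. *)

(** Stated for all shapes because it is applied both to columns of the plane and to row vectors of
    $F^4$. A line that misses [A] imposes nothing, so the spans of points of [A] suffice. *)
Definition thin (F : finFieldType) (m n : nat) (A : {set 'M[F]_(m, n)}) (k : nat) :=
  forall u, u \in A ->
    u != 0 /\ (#|[set v in A | v \in <[u]>%VS]| <= k)%N.

(** * Orthogonality of centred hyperplane indicators, and incidences in $F^n$ *)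

Section Orthogonality.
Variables (R : realFieldType) (F : finFieldType) (n : nat).
Implicit Types (u v w : 'rV[F]_n) (A B : {set 'rV[F]_n}).

Definition dot u v : F := (u *m v^T) 0 0.

Lemma dotC u v : dot u v = dot v u.
Proof. by rewrite /dot -[in LHS](trmxK u) -trmx_mul mxE. Qed.

Lemma dotDr u v w : dot u (v + w) = dot u v + dot u w.
Proof. by rewrite /dot linearD mulmxDr mxE. Qed.

Lemma dotZr u a v : dot u (a *: v) = a * dot u v.
Proof. by rewrite /dot linearZ -scalemxAr mxE. Qed.

Lemma dotZl u a v : dot (a *: u) v = a * dot u v.
Proof. by rewrite dotC dotZr dotC. Qed.

(** The columns of [cokermx u] are orthogonal to [u], and one of them is not orthogonal to [v]; it
    only has to be rescaled. *)
Lemma separating_vector u v :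
  v \notin <[u]>%VS -> exists2 w, dot u w = 0 & dot v w = 1.
Proof.
move=> vNu.
have : ~~ (v <= u)%MS.
  by apply: contra vNu => /sub_rVP[a ->]; apply/vlineP; exists a.
rewrite submxE => /rV0Pn[j nz].
pose x := (v *m cokermx u) 0 j.
exists (x^-1 *: (col j (cokermx u))^T); rewrite dotZr /dot trmxK colE mulmxA.
  by rewrite mulmx_coker mul0mx mxE mulr0.
by rewrite -colE mxE mulVf.
Qed.

(* [q] times the centred indicator of the hyperplane orthogonal to [u]. *)
Definition chi u v : R := #|F|%:R * (dot u v == 0)%:R - 1.

Lemma sum_addr_eq0 (a : F) : \sum_(c : F) ((a + c == 0)%:R : R) = 1.
Proof.
rewrite (bigD1 (- a)) //= subrr eqxx big1 ?addr0 // => c.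
by rewrite addrC addr_eq0 => /negbTE->.
Qed.

(** Translating by each [c *: w] and summing over [c] gives $q$ copies of the total, and regroups it
    into the vanishing sums along lines of direction [w]. *)
Lemma sum_shift_eq0 (H : 'rV[F]_n -> R) w :
  (forall v, \sum_(c : F) H (v + c *: w) = 0) -> \sum_v H v = 0.
Proof.
move=> H0; apply/eqP.
have q0 : #|F|%:R != 0 :> R by rewrite pnatr_eq0 -lt0n (cardD1 0).
rewrite -(mulrI_eq0 _ (mulfI q0)) mulr_natl -sumr_const.
have -> : \sum_(c in F) \sum_v H v = \sum_(c : F) \sum_v H (v + c *: w).
  by apply: eq_bigr => c _; rewrite [LHS](reindex_inj (addIr (c *: w))).
by rewrite exchange_big big1.
Qed.

(** Take [w] orthogonal to [u] but not to [v]. Along direction [w] the factor [chi u] is constant,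
    while [chi v] meets its hyperplane once and sums to $q-q=0$. *)
Lemma sum_chi_indep u v : v \notin <[u]>%VS -> \sum_w chi u w * chi v w = 0.
Proof.
case/separating_vector=> w uw vw; apply: (@sum_shift_eq0 _ w) => x.
under eq_bigr => c _ do rewrite /chi !dotDr !dotZr uw vw mulr0 addr0 mulr1.
rewrite -mulr_sumr sumrB -mulr_sumr sum_addr_eq0 sumr_const.
by rewrite mulr1 subrr mulr0.
Qed.

Lemma sum_chi u : u != 0 -> \sum_w chi u w = 0.
Proof.
move=> u0; have /separating_vector[w _ uw] : u \notin <[0 : 'rV[F]_n]>%VS.
  by apply: contra u0 => /vlineP[a ->]; rewrite scaler0.
apply: (@sum_shift_eq0 _ w) => x.
under eq_bigr => c _ do rewrite /chi !dotDr !dotZr uw mulr1.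
by rewrite sumrB -mulr_sumr sum_addr_eq0 sumr_const mulr1 subrr.
Qed.

Lemma chiZl a u w : a != 0 -> chi (a *: u) w = chi u w.
Proof. by move=> a0; rewrite /chi dotZl mulf_eq0 (negbTE a0). Qed.

Lemma chiZr a u w : a != 0 -> chi u (a *: w) = chi u w.
Proof. by move=> a0; rewrite /chi dotZr mulf_eq0 (negbTE a0). Qed.

Lemma sum_chi_sqr u : u != 0 ->
  \sum_w chi u w ^+ 2 = (#|F|%:R - 1) * #|F|%:R ^+ n.
Proof.
move=> u0.
(* [chi] takes only the values $q-1$ and $-1$, the roots of $X^2=(q-2)X+(q-1)$. *)
have E w : chi u w ^+ 2 = (#|F|%:R - 2) * chi u w + (#|F|%:R - 1).
  by rewrite /chi; case: (_ == 0); rewrite ?mulr1 ?mulr0; ring.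
under eq_bigr do rewrite E.
rewrite big_split /= -mulr_sumr sum_chi // mulr0 add0r sumr_const.
by rewrite [#|_|]card_mx mul1n -[X in X = _]mulr_natr natrX.
Qed.

Definition bias A w : R := \sum_(u in A) chi u w.

(** After expanding the square, independent pairs vanish by orthogonality. Each [u] keeps at most
    [k] proportional partners [v], for which [chi v] and [chi u] coincide. *)
Lemma bias_sqr_le A k : thin A k ->
  \sum_w bias A w ^+ 2 <= (#|F|%:R - 1) * #|F|%:R ^+ n * k%:R * #|A|%:R.
Proof.
move=> thA.
have -> : \sum_w bias A w ^+ 2 =
   \sum_(u in A) \sum_(v in A) \sum_w chi u w * chi v w.
  under eq_bigr => w _ do rewrite expr2 /bias mulr_suml.
  rewrite exchange_big; apply: eq_bigr => u _ /=.
  under eq_bigr => w _ do rewrite mulr_sumr.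
  by rewrite exchange_big.
have -> : (#|F|%:R - 1) * #|F|%:R ^+ n * k%:R * #|A|%:R
    = \sum_(u in A) (#|F|%:R - 1) * #|F|%:R ^+ n * k%:R :> R.
  by rewrite sumr_const mulr_natr.
have q1 : 1 <= #|F|%:R :> R by rewrite ler1n (cardD1 0).
apply: ler_sum => u uA; have [u0 le_k] := thA u uA.
rewrite (bigID (fun v => v \in <[u]>%VS)) /= [X in _ + X]big1 ?addr0; last first.
  by move=> v /andP[_ /sum_chi_indep].
apply: (@le_trans _ _ (\sum_(v in A | v \in <[u]>%VS) (#|F|%:R - 1) * #|F|%:R ^+ n)).
  apply: ler_sum => v /andP[vA /vlineP[a def_v]].
  have [v0 _] := thA v vA.
  have a0 : a != 0 by apply: contraNneq v0 => a0; rewrite def_v a0 scale0r.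
  rewrite -(sum_chi_sqr u0) le_eqVlt; apply/orP; left; apply/eqP.
  by apply: eq_bigr => w _; rewrite def_v chiZl.
rewrite sumr_const -[X in X <= _]mulr_natr.
apply: ler_wpM2l; first by rewrite mulr_ge0 ?exprn_ge0 ?subr_ge0.
rewrite ler_nat; apply: leq_trans le_k.
by rewrite cardsE.
Qed.

(** [bias A] is invariant under nonzero dilations of its argument, so restricting the sum to a thin
    [B] gains a factor $k/(q-1)$ over the sum on the whole space. *)
Lemma bias_sqr_thin_le A B k : thin A k -> thin B k ->
  \sum_(v in B) bias A v ^+ 2 <= #|F|%:R ^+ n * k%:R ^+ 2 * #|A|%:R.
Proof.
move=> thA thB.
have q1 : 0 < #|F|%:R - 1 :> R by rewrite subr_gt0 ltr1n card_finNzRing_gt1.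
rewrite -(ler_pM2l q1).
apply: (@le_trans _ _ (k%:R * \sum_w bias A w ^+ 2)); last first.
  apply: le_trans (ler_wpM2l _ (bias_sqr_le thA)) _; rewrite ?ler0n //.
  by rewrite le_eqVlt; apply/orP; left; apply/eqP; ring.
(* Each [v] in [B] is written as [a *: w] in $q-1$ ways, one for each nonzero [a]. *)
have -> : (#|F|%:R - 1) * \sum_(v in B) bias A v ^+ 2 =
    \sum_w \sum_(a | (a != 0 :> F) && (a *: w \in B)) bias A w ^+ 2.
  have cF : #|F|%:R - 1 = #|[pred a : F | a != 0]|%:R :> R.
    rewrite (cardD1 0) inE natrD addrAC subrr add0r; congr (_%:R); apply: eq_card => a.
    by rewrite !inE andbT.
  transitivity (\sum_(a : F | a != 0) \sum_(w | a *: w \in B) bias A w ^+ 2); last first.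
    by rewrite (exchange_big_dep predT).
  rewrite cF mulr_natl -sumr_const; apply: eq_bigr => a /= a0.
  rewrite [RHS](reindex_inj (can_inj (scalerKV a0))); apply: eq_big => v.
    by rewrite scalerKV.
  move=> _; congr (_ ^+ 2); apply: eq_bigr => u _.
  by rewrite chiZr ?invr_eq0.
rewrite mulr_sumr; apply: ler_sum => w _.
rewrite sumr_const -[X in X <= _]mulr_natl; apply: ler_wpM2r; first exact: sqr_ge0.
rewrite ler_nat.
(* If some dilate of [w] lies in [B], all such dilates lie on its line, so there are at most [k] of
   them. *)
have [/setP no|[b]] := set_0Vmem [set a | (a != 0 :> F) && (a *: w \in B)].
  rewrite eq_card0 // => a; by have := no a; rewrite !inE.
rewrite inE => /andP[b0 bwB]; have [bw0 le_k] := thB _ bwB.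
apply: leq_trans le_k.
have inj : injective (fun a : F => a *: w).
  have w0 : w != 0 by apply: contraNneq bw0 => ->; rewrite scaler0.
  move=> a c /eqP; rewrite -subr_eq0 -scalerBl scaler_eq0 (negbTE w0) orbF subr_eq0.
  by move/eqP.
rewrite -(card_image inj).
apply/subset_leq_card/subsetP => _ /imageP[a /andP[a0 awB] ->].
rewrite inE awB; apply/vlineP; exists (a / b).
by rewrite scalerA divfK.
Qed.

(** Cauchy-Schwarz in the form $2Kx\le x^2+K^2$ with $K=q^mk$. As [A] and [B] have equal size, both
    terms sum to at most $K^2|A|$; [n] is even so that $q^{n/2}$ is a power with natural
    exponent. *)
Lemma incidence_le A B k m : thin A k -> thin B k -> n = (2 * m)%N ->
  #|A| = #|B| ->
  \sum_(v in B) bias A v <= #|F|%:R ^+ m * k%:R * #|A|%:R.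
Proof.
move=> thA thB nE cAB.
have [->|[u uA]] := set_0Vmem A.
  by rewrite cards0 mulr0 big1 // => v _; rewrite /bias big_set0.
have k0 : 0 < k%:R :> R.
  rewrite ltr0n; apply: leq_trans (thA u uA).2.
  by rewrite card_gt0; apply/set0Pn; exists u; rewrite inE uA memv_line.
have q0 : 0 < #|F|%:R :> R by rewrite ltr0n (cardD1 0).
set K : R := #|F|%:R ^+ m * k%:R.
have K0 : 0 < K by exact: mulr_gt0 (exprn_gt0 m q0) k0.
have := bias_sqr_thin_le thA thB.
have -> : #|F|%:R ^+ n * k%:R ^+ 2 = K ^+ 2 :> R.
  by rewrite /K exprMn -exprM nE mulnC.
move=> le2.
have K2 : 0 < 2 * K by exact: mulr_gt0.
rewrite -(ler_pM2l K2).
rewrite mulr_sumr.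
apply: (@le_trans _ _ (\sum_(v in B) (bias A v ^+ 2 + K ^+ 2))).
  by apply: ler_sum => v _; rewrite -subr_ge0; have := sqr_ge0 (bias A v - K); lra.
rewrite big_split /= sumr_const -cAB -mulr_natr.
by apply: le_trans (lerD le2 (lexx _)) _; lra.
Qed.
End Orthogonality.

(** * Areas in the plane and the action of $SL_2$ *)

Section Plane.
Variable (F : finFieldType).
Implicit Types (e t : 'cV[F]_2) (g h : 'M[F]_2) (E T : {set 'cV[F]_2}).

Definition area e e' : F := \det (row_mx e e').

Lemma areaE e e' : area e e' = e 0 0 * e' 1 0 - e 1 0 * e' 0 0.
Proof.
rewrite /area (expand_det_row _ 0) !big_ord_recl big_ord0 /cofactor !det_mx11.
have l0 : lift 0 0 = 1 :> 'I_2 by apply: val_inj.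
have l1 : lift 1 0 = 0 :> 'I_2 by apply: val_inj.
have s0 : split (0 : 'I_(1 + 1)) = inl 0.
  by rewrite -(unsplitK (inl 0)); congr split; apply: val_inj.
have s1 : split (1 : 'I_(1 + 1)) = inr 0.
  by rewrite -(unsplitK (inr 0)); congr split; apply: val_inj.
rewrite !mxE !l0 !l1 s0 s1.
by ring.
Qed.

Lemma area_mulmx g e e' : area (g *m e) (g *m e') = \det g * area e e'.
Proof. by rewrite /area -mul_mx_row det_mulmx. Qed.

Lemma col2P e t : e 0 0 = t 0 0 -> e 1 0 = t 1 0 -> e = t.
Proof.
move=> h0 h1; apply/matrixP => i j; rewrite ord1.
by case: (unliftP 0 i) => [k|] ->; rewrite ?ord1 // (_ : lift 0 0 = 1) //;
  apply: val_inj.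
Qed.

Lemma area_surj e : e != 0 -> exists e', area e e' = 1.
Proof.
move=> e0; have [x0|x0] := eqVneq (e 0 0) 0.
  have y0 : e 1 0 != 0 by apply: contraNneq e0 => y0; apply/eqP/col2P; rewrite mxE.
  exists (\col_i (if i == 0 then - (e 1 0)^-1 else 0)).
  by rewrite areaE !mxE /=; field.
exists (\col_i (if i == 0 then 0 else (e 0 0)^-1)).
by rewrite areaE !mxE /=; field.
Qed.

Lemma area_eq0 e e' : e != 0 -> (area e e' == 0) = (e' \in <[e]>%VS).
Proof.
move=> e0; apply/eqP/vlineP => [|[c ->]]; last by rewrite areaE !mxE; ring.
have [s] := area_surj e0; rewrite !areaE => es ee'.
(* By Cramer's rule, $area(e,s)\,e'=area(e',s)\,e+area(e,e')\,s$; here the first area is 1 and the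
   last is 0. *)
exists (- (s 0 0 * e' 1 0 - s 1 0 * e' 0 0)); apply: col2P; rewrite !mxE.
  transitivity (e' 0 0 * 1 - s 0 0 * 0); first by ring.
  by rewrite -[X in _ * X - _]es -ee'; ring.
transitivity (e' 1 0 * 1 - s 1 0 * 0); first by ring.
by rewrite -[X in _ * X - _]es -ee'; ring.
Qed.

Definition SL : {set 'M[F]_2} := [set g | \det g == 1].

Lemma SL_inj2 g h e e' : area e e' != 0 ->
  g *m e = h *m e -> g *m e' = h *m e' -> g = h.
Proof.
move=> nz ge ge'.
have u : row_mx e e' \in unitmx by rewrite unitmxE unitfE.
have gh : g *m row_mx e e' = h *m row_mx e e' by rewrite !mul_mx_row ge ge'.
by rewrite -(mulmxK u g) gh mulmxK.
Qed.

Lemma SL_exists e e' t t' : area e e' = 1 -> area t t' = 1 ->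
  exists g, [/\ g \in SL, g *m e = t & g *m e' = t'].
Proof.
move=> ee tt; have u : row_mx e e' \in unitmx.
  by rewrite unitmxE unitfE -/(area e e') ee oner_eq0.
pose g : 'M_2 := row_mx t t' *m invmx (row_mx e e').
have /eq_row_mx[ge ge'] : row_mx (g *m e) (g *m e') = row_mx t t'.
  by rewrite -mul_mx_row mulmxKV.
exists g; split=> //; rewrite inE det_mulmx det_inv.
by rewrite -/(area t t') -/(area e e') ee tt invr1 mulr1.
Qed.

(** The solutions form an affine line $s+Ft$, where [s] is any one of them. *)
Lemma card_area1 t : t != 0 -> #|[set t' | area t t' == 1]| = #|F|.
Proof.
move=> t0; have [s ts] := area_surj t0.
have inj : injective (fun c : F => s + c *: t).
  move=> c d /addrI/eqP; rewrite -subr_eq0 -scalerBl scaler_eq0 (negbTE t0) orbF.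
  by rewrite subr_eq0 => /eqP.
rewrite -(card_imset _ inj); apply: eq_card => t'; rewrite inE.
apply/eqP/imsetP => [tt'|[c _ ->]].
  have : t' - s \in <[t]>%VS.
    rewrite -(area_eq0 _ t0); move: ts tt'; rewrite !areaE !mxE => <- /eqP.
    by rewrite -subr_eq0 => /eqP <-; apply/eqP; ring.
  by case/vlineP=> c ct; exists c; rewrite // -ct addrC subrK.
by rewrite -ts !areaE !mxE; ring.
Qed.

(** Complete [e] by [e'] to a pair of area 1. Then [g] is determined by [g *m e'], which can be any
    vector of area 1 with [t]. *)
Lemma card_SL_fiber e t : e != 0 -> t != 0 -> #|[set g in SL | g *m e == t]| = #|F|.
Proof.
move=> e0 t0; have [e' ee] := area_surj e0.
rewrite -(card_area1 t0) -(@card_in_imset _ _ (fun g => g *m e') [set g in SL | g *m e == t]).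
  apply: eq_card => t'; rewrite inE; apply/imsetP/eqP => [[g]|tt].
    by rewrite !inE => /andP[/eqP g1 /eqP <-] ->; rewrite area_mulmx g1 ee mulr1.
  by have [g [gSL ge ge']] := SL_exists ee tt; exists g;
    rewrite ?inE ?ge ?eqxx ?andbT //; rewrite inE in gSL.
move=> g h; rewrite !inE => /andP[_ /eqP ge] /andP[_ /eqP he] gh.
by apply: (SL_inj2 (e := e) (e' := e')) => //; rewrite ?ee ?oner_eq0 // ge he.
Qed.

(** Sort the matrices by the image of one fixed nonzero vector: at most $q^2$ images, each with a
    fibre of size $q$. *)
Lemma card_SL_le : (#|SL| <= #|F| ^ 3)%N.
Proof.
have [e e0] : exists e : 'cV[F]_2, e != 0.
  exists (const_mx 1); apply/eqP => /matrixP/(_ 0 0).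
  by rewrite !mxE => /eqP; rewrite oner_eq0.
rewrite -sum1_card (partition_big (fun g => g *m e) (fun t => t != 0)) /=; last first.
  move=> g; rewrite inE => /eqP g1; apply: contra e0 => /eqP ge0.
  apply/eqP; apply: (can_inj (mulKmx (_ : g \in unitmx)));
    first by rewrite unitmxE g1 unitr1.
  by rewrite ge0 mulmx0.
apply: (@leq_trans (\sum_(t : 'cV[F]_2) #|F|)); last first.
  by rewrite sum_nat_const [X in (X * _)%N]card_mx -expnSr.
rewrite big_mkcond; apply: leq_sum => t _; case: ifP => // t0.
rewrite sum1_card -(card_SL_fiber e0 t0); apply: eq_leq.
by apply: eq_card => g; rewrite !inE unfold_in /= inE.
Qed.

End Plane.

(** * Equal areas and the variance of the number of hits *)

Section Variance.
Variables (R : realFieldType) (F : finFieldType).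
Implicit Types (e t : 'cV[F]_2) (g h : 'M[F]_2) (E T : {set 'cV[F]_2}).

Lemma sum_mem (I : finType) (A : {set I}) (P : pred I) :
  (\sum_(i in A) P i = #|[set i in A | P i]|)%N.
Proof.
rewrite big_mkcond -sum1_card [RHS]big_mkcond; apply: eq_bigr => i _.
by rewrite inE; case: (i \in A); case: (P i).
Qed.

Lemma sum_setX (V : nmodType) (I J : finType) (A : {set I}) (B : {set J}) (f : I * J -> V) :
  \sum_(x in setX A B) f x = \sum_(i in A) \sum_(j in B) f (i, j).
Proof.
by rewrite pair_big; apply: eq_big => [[i j]|[i j] _] //; rewrite in_setX.
Qed.

(** The left block [f e] is nonzero, so it determines the point on its line. Projecting to it embeds
    the points of that line into the image under [f] of the points of [E] on the line of [e]. *)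
Lemma thin_row_mx E T k (f h : 'cV[F]_2 -> 'rV[F]_2) :
  injective f -> (forall c e, f (c *: e) = c *: f e) -> thin E k ->
  thin [set row_mx (f x.1) (h x.2) | x in setX E T] k.
Proof.
move=> f_inj fZ thE _ /imsetP[[e t] /setXP[/= eE tT] ->].
have [e0 le_k] := thE e eE.
have f0 : f 0 = 0 by rewrite -(scale0r (0 : 'cV_2)) fZ scale0r.
have fe0 : f e != 0 by rewrite -f0 (inj_eq f_inj).
split.
  by apply: contraNneq fe0 => /(congr1 lsubmx); rewrite row_mxKl linear0 => ->.
set L := [set v in _ | _].
rewrite -(@card_in_imset _ _ (@lsubmx F 1 2 2) L).
  apply: leq_trans le_k; apply: leq_trans (leq_imset_card f _).
  apply/subset_leq_card/subsetP => _ /imsetP[v vL ->].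
  move: vL; rewrite inE => /andP[/imsetP[[e1 t1] /setXP[/= e1E _] ->]] /vlineP[c].
  rewrite scale_row_mx row_mxKl => /eq_row_mx[fe1 _].
  by apply: imset_f; rewrite inE e1E; apply/vlineP; exists c; apply: f_inj; rewrite fZ.
move=> v w; rewrite !inE => /andP[_ /vlineP[c ->]] /andP[_ /vlineP[d ->]].
rewrite !scale_row_mx !row_mxKl => /eqP; rewrite -subr_eq0 -scalerBl scaler_eq0.
by rewrite (negbTE fe0) orbF subr_eq0 => /eqP->.
Qed.

(* The pairing of [rot e'] with [e] is [area e e'], so that equal areas become
   an orthogonality relation in [F^4]. *)
Definition rot e : 'rV[F]_2 := \row_i (if i == 0 then e 1 0 else - e 0 0).

Lemma rot_inj : injective rot.
Proof.
move=> e e' ee; apply: col2P.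
  by move/matrixP/(_ 0 1): ee; rewrite !mxE /= => /oppr_inj.
by move/matrixP/(_ 0 0): ee; rewrite !mxE.
Qed.

Lemma rotZ c e : rot (c *: e) = c *: rot e.
Proof. by apply/rowP => i; rewrite !mxE; case: ifP; rewrite ?mulrN. Qed.

Lemma dot_rot e e' : dot e^T (rot e') = area e e'.
Proof.
rewrite areaE /dot !mxE !big_ord_recl big_ord0 !mxE /=.
have -> : lift ord0 ord0 = 1 :> 'I_2 by apply: val_inj.
by ring.
Qed.

Lemma dot_row_mx (a b c d : 'rV[F]_2) :
  dot (row_mx a b) (row_mx c d) = dot a c + dot b d.
Proof. by rewrite /dot tr_row_mx mul_row_col mxE. Qed.

(** Incidence bound in dimension 4 for two encodings of $E\times T$. With $M=|E||T|$, the constant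
    part of [chi] gives the main term $M^2$, and the error is $q^2kM$. *)
Lemma equal_areas_le E T k : thin E k ->
  #|F|%:R * (\sum_(e in E) \sum_(e' in E) \sum_(t in T) \sum_(t' in T)
               (area e e' == area t t')%:R)
    <= (#|E|%:R * #|T|%:R) ^+ 2 + #|F|%:R ^+ 2 * k%:R * (#|E|%:R * #|T|%:R) :> R.
Proof.
move=> thE; pose X := setX E T.
pose al (x : 'cV[F]_2 * 'cV[F]_2) : 'rV[F]_(2 + 2) := row_mx x.1^T x.2^T.
(* The sign makes the pairing of [al (e, t)] with [be (e', t')] equal to $area(e,e')-area(t,t')$, up
   to the order of the arguments. *)
pose be (x : 'cV[F]_2 * 'cV[F]_2) : 'rV[F]_(2 + 2) := row_mx (rot x.1) (- rot x.2).
have al_inj : injective al.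
  by move=> [e t] [e' t'] /eq_row_mx[/= /trmx_inj-> /trmx_inj->].
have be_inj : injective be.
  by move=> [e t] [e' t'] /eq_row_mx[/= /rot_inj-> /oppr_inj/rot_inj->].
have thA : thin [set al x | x in X] k.
  apply: (thin_row_mx (f := trmx) (h := trmx)) => //; first exact: trmx_inj.
  by move=> c e; rewrite linearZ.
have thB : thin [set be x | x in X] k.
  exact: (thin_row_mx (f := rot) (h := fun t => - rot t) rot_inj rotZ).
have := @incidence_le R F _ _ _ k 2 thA thB erefl.
rewrite !card_imset // cardsX natrM => /(_ erefl).
rewrite /bias big_imset /=; last by move=> x y _ _; apply: be_inj.
under eq_bigr => x _ do
  rewrite (big_imset _ (in2W al_inj)) /=.
move=> le.
rewrite -lerBlDl; apply: le_trans le; rewrite le_eqVlt; apply/orP; left; apply/eqP.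
under [RHS]eq_bigr => x _ do rewrite sumrB sumr_const -mulr_sumr.
rewrite sumrB sumr_const -mulr_sumr cardsX -natrM; congr (_ * _ - _); last first.
  by rewrite -[RHS]mulr_natr expr2.
rewrite [RHS]exchange_big sum_setX; apply: eq_bigr => e eE.
under [RHS]eq_bigr => t tT do rewrite sum_setX.
rewrite [RHS]exchange_big; apply: eq_bigr => e' eE'.
apply: eq_bigr => t tT; apply: eq_bigr => t' t'T.
rewrite dot_row_mx /= dot_rot -scaleN1r dotZr dot_rot mulN1r subr_eq0.
by [].
Qed.

Lemma card_pair_images e e' T : area e e' != 0 ->
  (#|[set g in SL F | (g *m e \in T) && (g *m e' \in T)]|
    <= \sum_(t in T) \sum_(t' in T) (area e e' == area t t'))%N.
Proof.
move=> nz; pose f g := (g *m e, g *m e').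
rewrite -(@card_in_imset _ _ f); last first.
  by move=> g h _ _ [ge ge']; apply: SL_inj2 nz ge ge'.
rewrite pair_big /=.
have -> : (\sum_(p | (p.1 \in T) && (p.2 \in T)) (area e e' == area p.1 p.2) =
   \sum_(p in setX T T) (area e e' == area p.1 p.2))%N.
  by apply: eq_bigl => p; rewrite inE.
rewrite sum_mem; apply/subset_leq_card/subsetP => _ /imsetP[g g_hits ->].
move: g_hits; rewrite !inE => /andP[/eqP g1 /andP[-> ->]] /=.
by rewrite area_mulmx g1 mul1r.
Qed.

Lemma card_SL_images e T : e != 0 -> 0 \notin T ->
  (#|[set g in SL F | g *m e \in T]| = #|F| * #|T|)%N.
Proof.
move=> e0 T0; rewrite -sum1_card (partition_big (fun g => g *m e) (mem T)) /=; last first.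
  by move=> g; rewrite inE => /andP[].
rewrite mulnC -sum_nat_const; apply: eq_bigr => t tT.
rewrite sum1_card -(@card_SL_fiber F e t) //; last by apply: contraNneq T0 => <-.
apply: eq_card => g; rewrite unfold_in /= !inE.
by have [->|] := eqVneq (g *m e) t; rewrite ?tT ?andbF ?andbT.
Qed.

Definition hits E T g := (\sum_(e in E) (g *m e \in T))%N.

Lemma sum_hits E T : 0 \notin E -> 0 \notin T ->
  (\sum_(g in SL F) hits E T g = #|F| * (#|E| * #|T|))%N.
Proof.
move=> E0 T0; rewrite /hits exchange_big mulnCA -sum_nat_const; apply: eq_bigr => e eE.
by rewrite sum_mem card_SL_images //; apply: contraNneq E0 => <-.
Qed.

(** Independent pairs are counted by [card_pair_images]. For each [e] there are at most [k]
    dependent [e']; there only the condition on [g *m e] is kept, which holds for $q|T|$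
    matrices. *)
Lemma sum_hits_sqr E T k : thin E k -> 0 \notin T ->
  (\sum_(g in SL F) hits E T g ^ 2 <=
   \sum_(e in E) \sum_(e' in E) \sum_(t in T) \sum_(t' in T) (area e e' == area t t')
   + k * (#|F| * (#|E| * #|T|)))%N.
Proof.
move=> thE T0.
have -> : (\sum_(g in SL F) hits E T g ^ 2 = \sum_(e in E) \sum_(e' in E)
   #|[set g in SL F | (g *m e \in T) && (g *m e' \in T)]|)%N.
  under eq_bigr => g _ do rewrite -mulnn /hits big_distrl /=.
  rewrite exchange_big; apply: eq_bigr => e _.
  under eq_bigr => g _ do rewrite big_distrr /=.
  rewrite exchange_big; apply: eq_bigr => e' _.
  by rewrite -sum_mem; apply: eq_bigr => g _; rewrite mulnb.
have -> : (k * (#|F| * (#|E| * #|T|)) = \sum_(e in E) k * (#|F| * #|T|))%N.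
  by rewrite sum_nat_const; ring.
rewrite -big_split; apply: leq_sum => e eE /=; have [e0 le_k] := thE e eE.
apply: (@leq_trans (\sum_(e' in E) (\sum_(t in T) \sum_(t' in T) (area e e' == area t t')
    + (e' \in <[e]>%VS) * (#|F| * #|T|)))).
  apply: leq_sum => e' e'E; have [dep|indep] := boolP (e' \in _).
    rewrite mul1n -(card_SL_images e0 T0); apply: leq_trans (leq_addl _ _).
    by apply/subset_leq_card/subsetP => g; rewrite !inE => /and3P[-> ->].
  by rewrite addn0; apply: card_pair_images; rewrite area_eq0.
by rewrite big_split /= leq_add2l -big_distrl /= leq_mul2r sum_mem le_k orbT.
Qed.

(** With $M=|E||T|$, the centre $M/q^2$ is the mean number of hits when $|SL_2|$ is approximated by
    $q^3$. In the expanded square the main terms are at most $M^2/q$, $-2M^2/q$ and $M^2/q$; they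
    cancel and leave two errors $qkM$. *)
Lemma hits_variance E T k : thin E k -> 0 \notin T ->
  \sum_(g in SL F) ((hits E T g)%:R - #|E|%:R * #|T|%:R / #|F|%:R ^+ 2) ^+ 2
    <= 2 * k%:R * #|F|%:R * (#|E|%:R * #|T|%:R) :> R.
Proof.
move=> thE T0.
have E0 : 0 \notin E by apply/negP => /thE[]; rewrite eqxx.
have q0 : 0 < #|F|%:R :> R by rewrite ltr0n (cardD1 0).
set q : R := #|F|%:R in q0 *.
set M : R := #|E|%:R * #|T|%:R; set mu := M / _.
have h1 : \sum_(g in SL F) (hits E T g)%:R = q * M :> R.
  by rewrite -natr_sum sum_hits // !natrM.
have := sum_hits_sqr thE T0; rewrite -(ler_nat R) natrD !natrM !natr_sum.
under eq_bigr => g _ do rewrite natrX.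
set J := (X in X + _).
have := equal_areas_le T thE.
have -> : \sum_(e in E) \sum_(e' in E) \sum_(t in T) \sum_(t' in T)
   (area e e' == area t t')%:R = J :> R.
  rewrite /J; apply: eq_bigr => e _; rewrite natr_sum; apply: eq_bigr => e' _.
  by rewrite natr_sum; apply: eq_bigr => t _; rewrite natr_sum.
rewrite -/q -/M => leJ le2.
have cSL : #|SL F|%:R <= q ^+ 3 :> R by rewrite -natrX ler_nat card_SL_le.
have -> : \sum_(g in SL F) ((hits E T g)%:R - mu) ^+ 2 =
   \sum_(g in SL F) (hits E T g)%:R ^+ 2 - 2 * mu * (q * M) + #|SL F|%:R * mu ^+ 2.
  rewrite -h1 mulr_sumr -sumrB [#|_|%:R * _]mulr_natl -sumr_const -big_split /=.
  by apply: eq_bigr => g _; ring.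
have lJ : J <= M ^+ 2 / q + q * k%:R * M.
  rewrite -(ler_pM2l q0); apply: le_trans leJ _.
  by rewrite le_eqVlt; apply/orP; left; apply/eqP; field; rewrite gt_eqF.
have e1 : 2 * mu * (q * M) = 2 * (M ^+ 2 / q) by rewrite /mu; field; rewrite gt_eqF.
have e2 : #|SL F|%:R * mu ^+ 2 <= M ^+ 2 / q.
  apply: le_trans (ler_wpM2r (sqr_ge0 _) cSL) _.
  by rewrite le_eqVlt; apply/orP; left; apply/eqP; rewrite /mu; field; rewrite gt_eqF.
lra.
Qed.

End Variance.

(** * Lower bound for the image, and points seeing many directions *)

Section Directions.
Variable (F : finFieldType).
Implicit Types (E : {set 'cV[F]_2}) (S : {set 'M[F]_2}).

(** Every [g] in [S] has exactly $|E|$ hits. If $|T|<q^2/2$, the centre is at most $|E|/2$, so each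
    such [g] contributes at least $|E|^2/4$ to the variance. *)
Lemma card_mxact_ge (R : realFieldType) E S k : thin E k -> S \subset SL F ->
  let T := [set A *m e | A in S, e in E] in
  #|F|%:R ^+ 2 <= 2 * #|T|%:R :> R \/
  #|S|%:R * #|E|%:R <= 8 * k%:R * #|F|%:R * #|T|%:R :> R.
Proof.
move=> thE sSL T.
have E0 : 0 \notin E by apply/negP => /thE[]; rewrite eqxx.
have T0 : 0 \notin T.
  apply/imset2P => -[A e AS eE /esym Ae0].
  have Au : A \in unitmx.
    by move/subsetP/(_ A AS): sSL; rewrite inE unitmxE => /eqP->; rewrite unitr1.
  by move: E0; rewrite -(mulKmx Au e) in eE *; move: eE; rewrite Ae0 mulmx0 => ->.
have q0 : 0 < #|F|%:R :> R by rewrite ltr0n (cardD1 0).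
have [|ltT] := lerP (#|F|%:R ^+ 2) (2 * #|T|%:R : R); first by left.
right; have := hits_variance R thE T0.
set q := #|F|%:R in q0 ltT *; set s := _ / _ => var.
have var_S : #|S|%:R * (#|E|%:R - s) ^+ 2 <= 2 * k%:R * q * (#|E|%:R * #|T|%:R).
  apply: le_trans var; rewrite (big_setID S) /= (setIidPr sSL).
  rewrite mulr_natl -sumr_const -[X in X <= _]addr0; apply: lerD; last first.
    by apply: sumr_ge0 => g _; apply: sqr_ge0.
  rewrite le_eqVlt; apply/orP; left; apply/eqP; apply: eq_bigr => g gS.
  congr ((_%:R - _) ^+ 2); rewrite /hits -sum1_card; apply: eq_bigr => e eE.
  by rewrite imset2_f.
have [->|nE] := eqVneq #|E| 0%N; first by rewrite mulr0 !mulr_ge0 ?ler0n.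
have pE : 0 < #|E|%:R :> R by rewrite ltr0n lt0n.
have le_s : s <= #|E|%:R / 2.
  rewrite /s -mulrA ler_wpM2l ?ler0n // ler_pdivrMr ?exprn_gt0 //.
  by move: ltT; set x := #|T|%:R; lra.
have : #|S|%:R * (#|E|%:R / 2) ^+ 2 <= 2 * k%:R * q * (#|E|%:R * #|T|%:R).
  apply: le_trans var_S; apply: ler_wpM2l; first exact: ler0n.
  by rewrite ler_sqr ?nnegrE; lra.
move=> final; rewrite -(ler_pM2r pE).
move: final; lra.
Qed.

(** The value of $my_0-y_1$ labels the lines of slope [m]; the vertical direction is left out. *)
Definition isolated E (m : F) (x : 'cV[F]_2) :=
  [forall y in E, (m * y 0 0 - y 1 0 == m * x 0 0 - x 1 0) ==> (y == x)].

(** Isolated points lie on distinct lines of slope [m], and there are $q$ such lines. *)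
Lemma card_isolated E m : (#|[set x in E | isolated E m x]| <= #|F|)%N.
Proof.
rewrite -(@card_in_imset _ _ (fun x : 'cV[F]_2 => m * x 0 0 - x 1 0)) ?max_card //.
move=> y x; rewrite !inE => /andP[yE _] /andP[_ /forall_inP/(_ y yE)/implyP x_is] yx.
by apply/eqP/x_is/eqP.
Qed.

(* Along each slope at most [#|F|] points are isolated, whence at most
   [#|F|^2 <= #|F| #|E| / 4] pairs of a slope and a point isolated along it. *)
Lemma few_isolated E : (4 * #|F| <= #|E|)%N ->
  exists2 x, x \in E & (4 * #|[set m | isolated E m x]| <= #|F|)%N.
Proof.
move=> leE; apply/exists_inP; apply: contraLR leE; rewrite -ltnNge.
rewrite negb_exists => /forallP many.
have q0 : (0 < #|F|)%N by rewrite (cardD1 0).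
have sum_le : (\sum_(x in E) #|[set m | isolated E m x]| <= #|F| * #|F|)%N.
  have -> : (\sum_(x in E) #|[set m | isolated E m x]| =
      \sum_(m : F) #|[set x in E | isolated E m x]|)%N.
    transitivity (\sum_(x in E) \sum_(m : F) isolated E m x)%N.
      apply: eq_bigr => x _; rewrite -sum1_card big_mkcond; apply: eq_bigr => m _.
      by rewrite inE; case: isolated.
    by rewrite exchange_big; apply: eq_bigr => m _; rewrite sum_mem.
  rewrite -sum_nat_const; apply: leq_sum => m _; exact: card_isolated.
(* The strict inequality gained by negation is kept as $q+1$: it yields $4q(q+1)\le|E|(q+1)\le4q^2$,
   which is absurd. *)
have : (\sum_(x in E) #|F|.+1 <= \sum_(x in E) 4 * #|[set m | isolated E m x]|)%N.
  by apply: leq_sum => x xE; have := many x; rewrite xE -ltnNge.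
rewrite sum_nat_const -big_distrr /= => le; rewrite ltnNge; apply/negP => ge.
have := leq_mul ge (leqnn #|F|.+1); move: sum_le q0 le; clear.
set s := (\sum_(_ in _) _)%N; move: s #|E| #|F| => s a q; nia.
Qed.

(** Pick one other point of [E] along each slope in which [x] is not isolated. Distinct slopes give
    distinct lines through the origin after translation, hence thinness with constant 1. *)
Lemma direction_set E : (4 * #|F| <= #|E|)%N ->
  exists2 x, x \in E & exists D : {set 'cV[F]_2},
    [/\ D \subset [set e - x | e in E], thin D 1 & (3 * #|F| <= 4 * #|D|)%N].
Proof.
move=> /few_isolated[x xE few]; exists x => //.
pose G := [set m | ~~ isolated E m x].
have neighbour m : m \in G -> exists z : 'cV[F]_2,
    [&& z \in [set e - x | e in E], z 0 0 != 0 & z 1 0 == m * z 0 0].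
  rewrite inE negb_forall => /existsP[y]; rewrite !negb_imply => /and3P[yE /eqP yx neq].
  have y1 : (y - x) 1 0 = m * (y - x) 0 0.
    rewrite !mxE (_ : y 1 0 = m * y 0 0 - (m * y 0 0 - y 1 0)); last by ring.
    by rewrite yx; ring.
  exists (y - x); rewrite y1 eqxx andbT; apply/andP; split; first exact: imset_f.
  (* On a line of slope [m] through the origin, a zero first coordinate forces the zero vector. *)
  apply: contraNneq neq => y0; rewrite -[y == x]subr_eq0; apply/eqP/col2P.
    by rewrite y0 mxE.
  by rewrite y1 y0 mulr0 mxE.
(* The default 0 is never taken for [m] in [G], by [neighbour]. *)
pose f m := odflt 0 [pick z : 'cV[F]_2 |
  [&& z \in [set e - x | e in E], z 0 0 != 0 & z 1 0 == m * z 0 0]].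
have fP m : m \in G ->
    [/\ f m \in [set e - x | e in E], f m 0 0 != 0 & f m 1 0 = m * f m 0 0].
  move=> /neighbour[z zP]; rewrite /f; case: pickP => [w /and3P[? ? /eqP]|/(_ z)] //.
  by rewrite zP.
have slope m : m \in G -> m = f m 1 0 / f m 0 0.
  by case/fP=> _ nz ->; rewrite mulfK.
exists (f @: G); split.
- by apply/subsetP => _ /imsetP[m /fP[? _ _] ->].
- move=> _ /imsetP[m mG ->]; have [_ nz sl] := fP m mG; split.
    by apply: contraNneq nz => ->; rewrite mxE.
  apply: leq_trans (eq_leq (cards1 (f m))); apply/subset_leq_card/subsetP => v.
  rewrite !inE => /andP[/imsetP[m' m'G ->]] /vlineP[c fc].
  suff -> : m' = m by [].
  rewrite (slope _ m'G) fc !mxE -mulf_div divff ?mul1r -?slope //.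
  by have [_ + _] := fP m' m'G; apply: contraNneq => c0; rewrite fc c0 scale0r mxE.
- rewrite card_in_imset; last by move=> m m' mG m'G ff; rewrite (slope _ mG) ff -slope.
  have : (#|[set m | isolated E m x]| + #|~: [set m | isolated E m x]| = #|F|)%N.
    exact: cardsC.
  have -> : ~: [set m | isolated E m x] = G by apply/setP => m; rewrite !inE.
  by move: few; lia.
Qed.
End Directions.

(** * Both growth estimates, with explicit constants *)

Theorem theorem3p1 (R : realType) :
  (forall c : R, 0 < c ->
     exists c' : R, 0 < c' /\
       forall (p : nat) (E : {set 'cV['F_p]_2}) (S : {set 'M['F_p]_2}),
         prime p -> odd p -> S \subset SL2 p ->
         (4 * p <= #|E|)%N ->
         c * p%:R ^+ 2 <= #|S|%:R ->
         exists2 x : 'cV['F_p]_2,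
           x \in E & c' * p%:R ^+ 2 <= #|mxact S (translate E x)|%:R)
  /\
  (exists c : R, 0 < c /\
     forall (p k : nat) (E : {set 'cV['F_p]_2}) (S : {set 'M['F_p]_2}),
       prime p -> odd p -> S \subset SL2 p ->
       E != [set 0] ->
       lines_through_origin_le E k ->
       c * Num.min (p%:R ^+ 2) (#|S|%:R * #|E|%:R / (p%:R * k%:R))
         <= #|mxact S E|%:R).

Proof.
split=> [c c0|].
  (* One constant for each alternative of [card_mxact_ge]; in the second,
     $cq^2\cdot\frac34q\le|S||D|\le8q|T|$. *)
  exists (Num.min (2^-1) (c * 3 / 32)); split.
    by rewrite lt_min invr_gt0 ltr0n /= !mulr_gt0 ?invr_gt0.
  move=> p E S p_pr _ sSL leE leS.
  have pE : p%:R = #|'F_p|%:R :> R by rewrite card_Fp.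
  have {}leE : (4 * #|'F_p| <= #|E|)%N by rewrite card_Fp.
  move: leS; rewrite pE => leS.
  have [x xE [D [sDE thD leD]]] := direction_set leE; exists x => //.
  have sub : [set A *m e | A in S, e in D] \subset mxact S (translate E x).
    exact: imset2S.
  have q0 : 0 < #|'F_p|%:R :> R by rewrite ltr0n (cardD1 0).
  have leT : #|[set A *m e | A in S, e in D]|%:R <= #|mxact S (translate E x)|%:R :> R.
    by rewrite ler_nat subset_leq_card.
  apply: le_trans leT.
  move: leD; rewrite -(ler_nat R) !natrM => leD.
  have [big|big] := card_mxact_ge R thD sSL.
    apply: (@le_trans _ _ (2^-1 * #|'F_p|%:R ^+ 2)); last by lra.
    by rewrite ler_wpM2r ?exprn_ge0 ?ge_min ?lexx // ltW.
  apply: (@le_trans _ _ (c * 3 / 32 * #|'F_p|%:R ^+ 2)).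
    by rewrite ler_wpM2r ?exprn_ge0 ?ge_min ?lexx ?orbT // ltW.
  move: big leS leD q0; set q := #|'F_p|%:R; set s := #|S|%:R.
  set d := #|D|%:R; set t : R := #|_|%:R => big leS leD q0.
  have h : c * q ^+ 2 * (3 / 4 * q) <= s * d.
    by apply: ler_pM => //; rewrite ?mulr_ge0 ?exprn_ge0 ?ler0n //; lra.
  rewrite -(ler_pM2r q0); lra.
(* The 16 is the 8 of [card_mxact_ge] times the 2 lost when the origin is removed from [E]. *)
exists (16%:R^-1); split; first by rewrite invr_gt0 ltr0n.
move=> p k E S p_pr _ sSL En0 lines.
have -> : p%:R = #|'F_p|%:R :> R by rewrite card_Fp.
pose D := E :\ 0.
have thD : thin D k.
  move=> u /setD1P[u0 uE]; split=> //.
  have := lines <[u]>%VS; rewrite dim_vline u0 => /(_ erefl); apply: leq_trans.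
  by apply/subset_leq_card/subsetP => v; rewrite !inE => /andP[/andP[_ ->] ->].
(* If only the origin could remain, [E] is empty because it differs from the singleton of 0, and the
   minimum is at most 0. *)
have [D0|[u uD]] := set_0Vmem D.
  have E0 : E = set0.
    by apply/eqP; move/eqP: D0; rewrite setD_eq0 subset1 (negbTE En0).
  rewrite E0 cards0 mulr0 mul0r; apply: le_trans (ler0n _ _).
  by rewrite mulr_ge0_le0 ?invr_ge0 ?ler0n // ge_min lexx orbT.
have q0 : 0 < #|'F_p|%:R :> R by rewrite ltr0n (cardD1 0).
have k0 : 0 < k%:R :> R.
  rewrite ltr0n; apply: leq_trans (thD u uD).2.
  by rewrite card_gt0; apply/set0Pn; exists u; rewrite inE uD memv_line.
(* [D] is nonempty, so $|E|\le|D|+1\le2|D|$. *)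
have leE : #|E|%:R <= 2 * #|D|%:R :> R.
  rewrite -natrM ler_nat (cardsD1 0 E) -/D.
  have : (0 < #|D|)%N by rewrite card_gt0; apply/set0Pn; exists u.
  by case: (0 \in E); rewrite /= mul2n -addnn ?leq_add2r // leq_addl.
have leT : #|[set A *m e | A in S, e in D]|%:R <= #|mxact S E|%:R :> R.
  by rewrite ler_nat subset_leq_card // imset2S // subsetDl.
apply: le_trans leT; have [big|big] := card_mxact_ge R thD sSL.
  apply: (@le_trans _ _ (16%:R^-1 * #|'F_p|%:R ^+ 2)).
    by rewrite ler_wpM2l ?invr_ge0 ?ler0n // ge_min lexx.
  by have := sqr_ge0 (#|'F_p|%:R : R); lra.
apply: (@le_trans _ _ (16%:R^-1 * (#|S|%:R * #|E|%:R / (#|'F_p|%:R * k%:R)))).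
  by rewrite ler_wpM2l ?invr_ge0 ?ler0n // ge_min lexx orbT.
have qk0 : 0 < #|'F_p|%:R * k%:R :> R by exact: mulr_gt0.
rewrite mulrA ler_pdivrMr //.
have : #|S|%:R * #|E|%:R <= #|S|%:R * (2 * #|D|%:R) :> R by rewrite ler_wpM2l ?ler0n.
move: big; set t : R := #|[set _ | _ in _, _ in _]|%:R; lra.
Qed.
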